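(* Let $\Gamma$ be a connected $k$-regular graph with four distinct eigenvalues and an indubitable partition $\Pi$ with parameters $(0,b)$. Then $\Gamma$ generates an imprimitive $3$-class association scheme in which one of the other relations (i.e. a non-trivial relation other than $\Gamma$) is a disjoint union of $k/b+1$ cliques if and only if the indubitable partition $\Pi$ is full.
   Context: Graphs are finite, simple and undirected; eigenvalues of $\Gamma$ are those of its $01$-adjacency matrix $A$. A partition $\Pi$ of the vertex set of a connected graph $\Gamma$ (into nonempty cells) is indubitable with parameters $(a,b)$ if for each cell $\mathcal{P}\in\Pi$ and each vertex $x$, the number of neighbors of $x$ in $\mathcal{P}$ equals $a$ if $x\in\mathcal{P}$, and equals $b$ otherwise. An indubitable partition with $r+1\ge2$ cells corresponds to the eigenvalue $\lambda=a-b$ of $\Gamma$; it is full if $r$ equals the multiplicity of $\lambda$ as an eigenvalue of $\Gamma$. (For parameters $(0,b)$: $\lambda=-b$ and $r=k/b$.) A (symmetric) $d$-class association scheme on a vertex set is a partition of the edge set of the complete graph into (nonempty) spanning subgraphs (the non-trivial relations) with adjacency matrices $B_1,\dots,B_d$ such that, with $B_0=I$, the span $\langle B_0,\dots,B_d\rangle$ is closed under matrix multiplication; this span is the Bose-Mesner algebra. The scheme is imprimitive if at least one of its non-trivial relations is a disconnected graph. A graph $\Gamma$ generates the scheme if it is one of the non-trivial relations and its adjacency algebra (the span of all powers of $A$) equals the Bose-Mesner algebra. *)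

(* Defs.v *)
From HB Require Import structures.
From mathcomp Require Import all_boot all_order all_algebra.
Set Implicit Arguments.
Unset Strict Implicit.
Unset Printing Implicit Defensive.

Import GRing.Theory.
Local Open Scope ring_scope.

Section Graphs.
Variable T : finType.
Implicit Types (e : rel T) (P : {set {set T}}).

Definition simple_graph e := symmetric e /\ irreflexive e.

Definition connected_graph e := forall x y : T, connect e x y.

Definition regular_graph e (k : nat) := forall x : T, #|[set y | e x y]| = k.

(* The mathcomp predicate [partition] already requires nonempty cells. *)
Definition indubitable e P (a b : nat) :=
  partition P [set: T] /\
  forall X x, X \in P -> #|[set y in X | e x y]| = if x \in X then a else b.

(* Cliques may be single vertices. *)
Definition disjoint_union_of_cliques e (m : nat) :=
  exists Q : {set {set T}},
    [/\ partition Q [set: T], #|Q| = m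
      & forall x y, e x y = (x != y) && (y \in pblock Q x)].

End Graphs.

Section Spectra.
Variables (C : numClosedFieldType) (T : finType).
Implicit Types (e : rel T) (P : {set {set T}}).

Definition adjmx e : 'M[C]_#|T| :=
  \matrix_(i, j) (e (enum_val i) (enum_val j))%:R.

Definition num_distinct_eigenvalues e (m : nat) :=
  exists s : seq C,
    [/\ uniq s, size s = m & forall z, (z \in s) = eigenvalue (adjmx e) z].

Definition eigenvalue_multiplicity e (z : C) : nat :=
  \rank (eigenspace (adjmx e) z).

(* An indubitable partition with r + 1 >= 2 cells corresponds to the
   eigenvalue a - b. *)
Definition full_partition e P (a b : nat) :=
  exists r : nat, [/\ (0 < r)%N, #|P| = r.+1
    & r = eigenvalue_multiplicity e (a%:R - b%:R)].

(* Membership in the span of all powers of the adjacency matrix, including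
   the zeroth power. *)
Definition in_adjacency_algebra e (M : 'M[C]_#|T|) :=
  exists (m : nat) (c : 'I_m -> C), M = \sum_(i < m) c i *: adjmx e ^+ i.

Section Schemes.
Variables (d : nat) (B : 'I_d -> rel T).

Definition Bose_Mesner : {vspace 'M[C]_#|T|} :=
  <<1%:M :: [seq adjmx (B i) | i : 'I_d]>>%VS.

(* [B] lists the d non-trivial relations. *)
Definition association_scheme :=
  [/\ forall i, simple_graph (B i),
      forall i, exists x y, B i x y,
      forall x y, x != y -> exists! i, B i x y
    & forall M N, M \in Bose_Mesner -> N \in Bose_Mesner ->
        M *m N \in Bose_Mesner].

Definition imprimitive_scheme := exists i, ~ connected_graph (B i).

Definition generates_scheme e :=
  (exists i, B i =2 e) /\
  forall M, in_adjacency_algebra e M <-> M \in Bose_Mesner.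

End Schemes.
End Spectra.

(* Main.v *)
(** Let [K] be the same-cell matrix of the partition, [J] the all-ones matrix,
    [A] the adjacency matrix, [n] the number of vertices and [m] the number of
    cells.  The partition being indubitable with parameters [(0, b)] means
    [A K = b (J - K)]; all cells then have size [n / m], and
    [E = (m K - J) / n] is a symmetric idempotent of rank [m - 1] whose rows
    are eigenvectors for [- b].

    If the partition is full, the row space of [E] is the whole eigenspace, so
    [E], and with it [K], is a polynomial in [A]; so is [J] by connectivity.
    The matrices [I], [A], [K - I], [J - K - A] are nonzero (otherwise [I] or
    [A] would lie in the span of [J] and [K], which leaves at most three
    eigenvalues [k], [- b], [0]), hence they span the 4-dimensional adjacency
    algebra.

    Conversely let [L] be the matrix of the cliques.  The entries of [A L]
    depend only on the relation of the two vertices.  If they are constant on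
    pairs from different cliques, the cliques form an indubitable partition
    with the same parameters, its projection is a polynomial in [A], and so has
    the full eigenspace of [- b] as row space.  Otherwise every neighbourhood
    is a union of cliques, [A L = c A], whence [L K = c K] and [L = K], so that
    [A] is a multiple of [J - K], which again leaves only three eigenvalues. *)
Require Import Defs.
From HB Require Import structures.
From mathcomp Require Import all_boot all_order all_algebra.
From mathcomp Require Import ring.
Set Implicit Arguments.
Unset Strict Implicit.
Unset Printing Implicit Defensive.
Import Order.TTheory GRing.Theory Num.Theory.
Local Open Scope ring_scope.

(** * Polynomials in a matrix and their action on eigenvectors *)

Section PowerSpan.
Variable F : fieldType.

(** Convertible with [in_adjacency_algebra] when [A] is an adjacency matrix, but stated for any
    square matrix, of size 0 included. *)
Definition powspan n (A M : 'M[F]_n) :=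
  exists (m : nat) (c : 'I_m -> F), M = \sum_(i < m) c i *: A ^+ i.

Lemma horner_mx_sum n (A : 'M[F]_n.+1) (p : {poly F}) :
  horner_mx A p = \sum_(i < size p) p`_i *: A ^+ i.
Proof.
rewrite -[p in LHS]coefK poly_def linear_sum /=.
by apply: eq_bigr => i _; rewrite linearZ /= rmorphXn /= horner_mx_X.
Qed.

Lemma powspan_hornerP n (A M : 'M[F]_n.+1) :
  powspan A M <-> exists p, M = horner_mx A p.
Proof.
split=> [[m [c ->]]|[p ->]]; last first.
  by exists (size p), (fun i => p`_i); rewrite horner_mx_sum.
exists (\sum_(i < m) c i *: 'X^i); rewrite linear_sum /=.
by apply: eq_bigr => i _; rewrite linearZ /= rmorphXn /= horner_mx_X.
Qed.

Lemma powspan1 n (A : 'M[F]_n) : powspan A 1%:M.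
Proof. by exists 1%N, (fun=> 1); rewrite big_ord1 scale1r expr0. Qed.

Lemma powspan_id n (A : 'M[F]_n) : powspan A A.
Proof.
exists 2%N, (fun i => (i == 1%N :> nat)%:R).
by rewrite !big_ord_recl big_ord0 /= scale0r scale1r expr1 add0r addr0.
Qed.

Lemma powspanZ n (A M : 'M[F]_n) a : powspan A M -> powspan A (a *: M).
Proof.
case=> m [c ->]; exists m, (fun i => a * c i); rewrite scaler_sumr.
by apply: eq_bigr => i _; rewrite scalerA.
Qed.

Lemma powspanD n (A M N : 'M[F]_n) :
  powspan A M -> powspan A N -> powspan A (M + N).
Proof.
case: n A M N => [|n] A M N.
  by move=> hM _; rewrite [_ + _]flatmx0 -[0](flatmx0 M).
move=> /powspan_hornerP[p ->] /powspan_hornerP[q ->].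
by apply/powspan_hornerP; exists (p + q); rewrite linearD.
Qed.

Lemma powspanB n (A M N : 'M[F]_n) :
  powspan A M -> powspan A N -> powspan A (M - N).
Proof.
by move=> hM hN; rewrite -scaleN1r; apply: powspanD => //; apply: powspanZ.
Qed.

Lemma powspanM n (A M N : 'M[F]_n) :
  powspan A M -> powspan A N -> powspan A (M *m N).
Proof.
case: n A M N => [|n] A M N.
  by move=> hM _; rewrite [_ *m _]flatmx0 -[0](flatmx0 M).
move=> /powspan_hornerP[p ->] /powspan_hornerP[q ->].
by apply/powspan_hornerP; exists (p * q); rewrite rmorphM.
Qed.

Lemma eigen_mulmxX m n (A : 'M[F]_n) (v : 'M_(m, n)) z i :
  v *m A = z *: v -> v *m A ^+ i = z ^+ i *: v.
Proof.
move=> vA; elim: i => [|i IH]; first by rewrite !expr0 scale1r mulmx1.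
by rewrite exprSr [A ^+ i * A]/(_ *m _) mulmxA IH -scalemxAl vA scalerA -exprSr.
Qed.

(** The scalar is the value at [z] of the polynomial that expresses [M], so one [a] serves all
    eigenvectors for [z]. *)
Lemma powspan_eigen n (A M : 'M[F]_n) z : powspan A M ->
  exists a, forall m (v : 'M_(m, n)), v *m A = z *: v -> v *m M = a *: v.
Proof.
case=> d [c ->]; exists (\sum_(i < d) c i * z ^+ i) => m v vA.
rewrite mulmx_sumr scaler_suml; apply: eq_bigr => i _.
by rewrite -scalemxAr (eigen_mulmxX _ vA) scalerA.
Qed.

Lemma horner_mx_eigen m n (A : 'M[F]_n.+1) (v : 'M_(m, n.+1)) z p :
  v *m A = z *: v -> v *m horner_mx A p = p.[z] *: v.
Proof.
move=> vA; rewrite horner_mx_sum horner_coef mulmx_sumr scaler_suml.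
by apply: eq_bigr => i _; rewrite -scalemxAr (eigen_mulmxX _ vA) scalerA.
Qed.

Lemma trmx_horner_mx n (A : 'M[F]_n.+1) p :
  A^T = A -> (horner_mx A p)^T = horner_mx A p.
Proof.
move=> symA; rewrite !horner_mx_sum linear_sum /=; apply: eq_bigr => i _.
rewrite linearZ /=; congr (_ *: _); elim: (i : nat) => [|j IH].
  by rewrite expr0 trmx1.
by rewrite exprSr trmx_mul symA IH -[LHS]/(A * _) -exprS exprSr.
Qed.

(** Division by the annihilating polynomial [p] leaves a remainder of degree less than [d], the
    degree of [p]. *)
Lemma powspan_vspace n (A M : 'M[F]_n) (p : {poly F}) d :
    (size p).-1 = d -> p != 0 -> \sum_(i < size p) p`_i *: A ^+ i = 0 ->
  powspan A M -> M \in <<[seq A ^+ i | i <- iota 0 d]>>%VS.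
Proof.
case: n A M => [|n] A M; first by rewrite (flatmx0 M) => *; rewrite mem0v.
rewrite -horner_mx_sum => sp p0 pA0 /powspan_hornerP[q ->].
rewrite (divp_eq q p) rmorphD rmorphM /= pA0 mulr0 add0r horner_mx_sum.
apply: memv_suml => i _; apply/memvZ/memv_span/mapP; exists (i : nat) => //.
rewrite mem_iota add0n /= -sp -ltnS prednK ?size_poly_gt0 //.
by apply: leq_ltn_trans (ltn_ord i) _; rewrite ltn_modp.
Qed.

Lemma vspace_powspan n (A M : 'M[F]_n) d :
  M \in <<[seq A ^+ i | i <- iota 0 d]>>%VS -> powspan A M.
Proof.
move=> hM; have sz : size [seq A ^+ i | i <- iota 0 d] == d.
  by rewrite size_map size_iota.
rewrite (@coord_span _ _ _ (Tuple sz) M hM).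
exists d, (fun i => coord (Tuple sz) i M); apply: eq_bigr => i _ /=.
by rewrite (nth_map 0%N) ?size_iota // nth_iota.
Qed.

(** In the rank factorization of [E] as [col_base E] times [row_base E], idempotence forces the
    product in the opposite order to be the identity of size [\rank E], and the trace does not see
    the order. *)
Lemma mxtrace_idem n (E : 'M[F]_n) : E *m E = E -> \tr E = (\rank E)%:R.
Proof.
move=> EE; have rc : row_base E *m col_base E = 1%:M.
  apply: (row_free_inj (row_base_free E));
    apply: (row_full_inj (col_base_full E)).
  rewrite /= mul1mx -(mulmxA (row_base E)) (mulmxA (col_base E)).
  by rewrite !mulmx_base EE.
by rewrite -{1}[E]mulmx_base mxtrace_mulC rc mxtrace1.
Qed.

(* A nonzero idempotent polynomial in [A] whose rows are eigenvectors for [z]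
   acts as a nonzero scalar on the whole eigenspace. *)
Lemma powspan_idem_eigenspace n (A E : 'M[F]_n) z :
    powspan A E -> E *m E = E -> E != 0 -> E *m A = z *: E ->
  (eigenspace A z :=: E)%MS.
Proof.
move=> EA EE E0 Ez; have [a ha] := powspan_eigen z EA.
have a1 : a = 1.
  have /eqP := ha _ _ Ez; rewrite EE -subr_eq0 -{1}[E]scale1r -scalerBl.
  by rewrite scaler_eq0 (negPf E0) orbF subr_eq0 => /eqP.
have /eigenspaceP sE := Ez; apply/eqmxP; rewrite sE andbT.
have /eigenspaceP/ha := submx_refl (eigenspace A z).
by rewrite a1 scale1r => <-; apply: submxMl.
Qed.

End PowerSpan.

(** * Real symmetric matrices: annihilating polynomial and eigenprojections *)

Section Spectral.
Variable C : numClosedFieldType.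

(** A real symmetric matrix is normal, hence diagonalizable, so a polynomial vanishing at every
    eigenvalue kills it. *)
Lemma real_symmetric_annihilator n (A : 'M[C]_n) (s : seq C) :
    A^T = A -> A \is a realmx -> (forall z, eigenvalue A z -> z \in s) ->
  let p := \prod_(z <- s) ('X - z%:P) in \sum_(i < size p) p`_i *: A ^+ i = 0.
Proof.
case: n A => [|n] A symA realA sA /=; first by rewrite [LHS]flatmx0.
rewrite -horner_mx_sum.
have nA : A \is normalmx.
  apply/hermitian_normalmx/realsym_hermsym => //.
  by apply/is_hermitianmxP; rewrite expr0 scale1r map_mx_id.
have /orthomx_spectralP AE := nA.
set V := spectralmx A in AE; set d := spectral_diag A in AE.
have Vu : V \in unitmx by apply: spectral_unit.
rewrite AE horner_mx_uconjC // horner_mx_diag.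
suff -> : map_mx (horner (\prod_(z <- s) ('X - z%:P))) d = 0.
  by rewrite linear0 mulmx0 mul0mx.
apply/rowP => j; rewrite !mxE; apply/rootP; rewrite root_prod_XsubC.
(* The rows of the diagonalizing matrix [V] are eigenvectors, nonzero because [V] is invertible. *)
apply: sA; apply/eigenvalueP; exists (row j V).
  rewrite {1}AE -row_mul !mulmxA mulmxV // mul1mx mul_diag_mx.
  by apply/rowP => l; rewrite !mxE.
apply/eqP => rV0; have := mulmxV Vu => /(congr1 (row j)).
rewrite row_mul rV0 mul0mx => /rowP/(_ j); rewrite !mxE eqxx => /eqP.
by rewrite eq_sym oner_eq0.
Qed.

(* [p(A)], with [p] vanishing at the other eigenvalues, has its rows in the
   eigenspace, so it is a multiple of the symmetric projection [E]. *)
Lemma powspan_eigenprojection n (A E : 'M[C]_n) (s : seq C) z :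
    A^T = A -> A \is a realmx -> uniq s ->
    (forall x, eigenvalue A x -> x \in s) -> z \in s ->
    E^T = E -> E *m E = E -> E *m A = z *: E ->
    \rank E = \rank (eigenspace A z) ->
  powspan A E.
Proof.
case: n A E => [|n] A E symA realA us sA zs symE EE Ez rE.
  by rewrite [E]flatmx0 -[0](flatmx0 1%:M); apply: powspan1.
have /= := real_symmetric_annihilator symA realA sA.
rewrite -horner_mx_sum (big_rem z zs) /= rmorphM /= rmorphB /= horner_mx_X.
rewrite horner_mx_C; set p := \prod_(_ <- _) _ => /eqP.
rewrite -[_ * _]/(_ *m _) => pA0.
have pz : p.[z] != 0.
  by rewrite -rootE root_prod_XsubC mem_rem_uniq // inE eqxx.
have sp : (horner_mx A p <= E)%MS.
  suff -> : (E :=: eigenspace A z)%MS.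
    apply/eigenspaceP/eqP; rewrite -subr_eq0 -mul_mx_scalar -mulmxBr.
    rewrite -[horner_mx A p](trmx_horner_mx p symA) -[A - _]trmxK -trmx_mul.
    by rewrite linearB /= symA tr_scalar_mx (eqP pA0) trmx0.
  apply/eqmxP; have /eigenspaceP sE := Ez; rewrite sE /=.
  by rewrite -(mxrank_leqif_sup sE).2 rE.
(* Since the rows of [p(A)] lie in the row space of [E], [p(A) E = p(A)]; transposing gives
   [E p(A) = p(A)], whose left side is [p(z) E]. *)
have pE : horner_mx A p = p.[z] *: E.
  have h : horner_mx A p *m E = horner_mx A p.
    by have /submxP[X ->] := sp; rewrite -mulmxA EE.
  rewrite -(horner_mx_eigen p Ez) -[RHS]trmxK trmx_mul (trmx_horner_mx p symA).
  by rewrite symE h (trmx_horner_mx p symA).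
apply/powspan_hornerP; exists (p.[z]^-1 *: p).
by rewrite linearZ /= pE scalerA mulVf // scale1r.
Qed.

End Spectral.

(** The diagonal is included, so this is an equivalence relation, unlike the clique graphs of
    [disjoint_union_of_cliques]. *)
Definition same_cell (T : finType) (P : {set {set T}}) : rel T :=
  fun x y => y \in pblock P x.

(** * Adjacency matrices, with entries indexed by vertices *)

Section AdjacencyMatrices.
Variables (C : numClosedFieldType) (T : finType).
Implicit Types (e f : rel T) (x y z : T).
Local Notation er := enum_rank.
Local Notation J := (adjmx C (fun _ _ : T => true)).

Lemma adjmxE e x y : adjmx C e (er x) (er y) = (e x y)%:R.
Proof. by rewrite mxE !enum_rankK. Qed.

Lemma rank_matrixP (M N : 'M[C]_#|T|) :
  (forall x y, M (er x) (er y) = N (er x) (er y)) -> M = N.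
Proof.
by move=> h; apply/matrixP => i j; rewrite -(enum_valK i) -(enum_valK j) h.
Qed.

Lemma big_rank (F : 'I_#|T| -> C) : \sum_i F i = \sum_x F (er x).
Proof. by rewrite (reindex er) //; apply: onW_bij; apply: enum_rank_bij. Qed.

Lemma mul_adjmxE e f x y :
  (adjmx C e *m adjmx C f) (er x) (er y) = #|[set z | e x z && f z y]|%:R.
Proof.
rewrite mxE big_rank -sum1_card natr_sum [RHS]big_mkcond /=.
apply: eq_bigr => z _; rewrite !adjmxE inE -natrM mulnb.
by case: (e x z && f z y).
Qed.

Lemma tr_adjmx e : symmetric e -> (adjmx C e)^T = adjmx C e.
Proof.
by move=> sym_e; apply: rank_matrixP => x y; rewrite mxE !adjmxE sym_e.
Qed.

Lemma adjmx_real e : adjmx C e \is a realmx.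
Proof. by apply/mxOverP => i j; rewrite mxE; apply: realn. Qed.

Lemma eq_adjmx e f : e =2 f -> adjmx C e = adjmx C f.
Proof. by move=> ef; apply: rank_matrixP => x y; rewrite !adjmxE ef. Qed.

Lemma adjmx_eq0 e : adjmx C e = 0 -> forall x y, ~~ e x y.
Proof.
move=> e0 x y; have := adjmxE e x y; rewrite e0 mxE => /eqP.
by rewrite eq_sym pnatr_eq0 eqb0.
Qed.

Lemma tr_J : J^T = J.
Proof. exact: tr_adjmx. Qed.

Lemma mul_JJ : J *m J = #|T|%:R *: J.
Proof.
apply: rank_matrixP => x y; rewrite mul_adjmxE mxE adjmxE mulr1.
by rewrite -cardsT; congr (#|pred_of_set _|%:R); apply/setP => z; rewrite !inE.
Qed.

Lemma mul_adjmxJ e k : regular_graph e k -> adjmx C e *m J = k%:R *: J.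
Proof.
move=> reg_e; apply: rank_matrixP => x y; rewrite mul_adjmxE mxE adjmxE mulr1.
by rewrite -(reg_e x); congr (#|pred_of_set _|%:R); apply/setP => z;
  rewrite !inE andbT.
Qed.

Lemma mul_Jadjmx e k : symmetric e -> regular_graph e k ->
  J *m adjmx C e = k%:R *: J.
Proof.
move=> sym_e reg_e; rewrite -[LHS]trmxK trmx_mul tr_J (tr_adjmx sym_e).
by rewrite (mul_adjmxJ reg_e) linearZ /= tr_J.
Qed.

(* The Laplacian form: if [v A = k v] then the sum of [|v_x - v_y|^2] over
   adjacent pairs vanishes. *)
Lemma regular_connected_eigenspace e k :
    symmetric e -> connected_graph e -> regular_graph e k ->
  (\rank (eigenspace (adjmx C e) k%:R) <= 1)%N.
Proof.
move=> sym_e con_e reg_e.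
suff h : (eigenspace (adjmx C e) k%:R <= (const_mx 1 : 'rV[C]_#|T|))%MS.
  exact: leq_trans (mxrankS h) (rank_leq_row _).
apply/row_subP => i.
have /eigenspaceP : (row i (eigenspace (adjmx C e) k%:R) <= eigenspace (adjmx
  C e) k%:R)%MS.
  exact: row_sub.
move: (row i _) => v vA {i}; pose w x := v 0 (er x).
have wA y : \sum_x (e x y)%:R * w x = k%:R * w y.
  have /rowP/(_ (er y)) := vA; rewrite !mxE big_rank => <-.
  by apply: eq_bigr => x _; rewrite adjmxE mulrC.
have degl y : \sum_x (e x y)%:R = k%:R :> C.
  rewrite -(reg_e y) -sum1_card natr_sum [RHS]big_mkcond /=;
    apply: eq_bigr => x _.
  by rewrite inE sym_e; case: (e y x).
have degr x : \sum_y (e x y)%:R = k%:R :> C.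
  by rewrite -(degl x); apply: eq_bigr => y _; rewrite sym_e.
have lap : \sum_x \sum_y (e x y)%:R * `|w x - w y| ^+ 2 = 0.
  (* The square expands into two diagonal and two cross sums. The former by regularity, the latter
     by [wA], all equal k times the sum of the squared norms of [w]. *)
  transitivity (\sum_x \sum_y ((e x y)%:R * (w x * (w x)^*) +
    (e x y)%:R * (w y * (w y)^*)
     - ((e x y)%:R * (w x * (w y)^*) + (e x y)%:R * (w y * (w x)^*)))).
    apply: eq_bigr => x _; apply: eq_bigr => y _.
    rewrite normCK rmorphB /=; ring.
  under eq_bigr => x _ do rewrite sumrB !big_split /=.
  rewrite sumrB !big_split /=.
  have -> : \sum_x \sum_y (e x y)%:R * (w x * (w x)^*) =
    \sum_x k%:R * (w x * (w x)^*).
    by apply: eq_bigr => x _; rewrite -mulr_suml degr.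
  have -> : \sum_x \sum_y (e x y)%:R * (w y * (w y)^*) =
    \sum_x k%:R * (w x * (w x)^*).
    by rewrite exchange_big; apply: eq_bigr => y _; rewrite -mulr_suml degl.
  have -> : \sum_x \sum_y (e x y)%:R * (w x * (w y)^*) =
    \sum_x k%:R * (w x * (w x)^*).
    rewrite exchange_big; apply: eq_bigr => y _; rewrite mulrA -wA mulr_suml.
    by apply: eq_bigr => x _; rewrite mulrA.
  have -> : \sum_x \sum_y (e x y)%:R * (w y * (w x)^*) =
    \sum_x k%:R * (w x * (w x)^*).
    apply: eq_bigr => y _; rewrite mulrA -wA mulr_suml.
    by apply: eq_bigr => x _; rewrite mulrA sym_e.
  by rewrite subrr.
have wE x y : e x y -> w x = w y.
  move=> exy; have ge0 x' y' : 0 <= (e x' y')%:R * `|w x' - w y'| ^+ 2.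
    by rewrite mulr_ge0 ?ler0n ?exprn_ge0.
  have /eqP := lap; rewrite psumr_eq0; last by move=> *; apply: sumr_ge0.
  move=> /allP/(_ x (mem_index_enum _));
    rewrite psumr_eq0 // => /allP/(_ y (mem_index_enum _)).
  by rewrite exy mul1r /= sqrf_eq0 normr_eq0 subr_eq0 => /eqP.
have wC x y : w x = w y.
  have /connectP[p] := con_e x y; elim: p x => [|z p IH] x /=;
    first by move=> _ ->.
  by move=> /andP[/wE -> pz] yE; apply: IH.
(* The proportionality factor is the value at some vertex, so the empty graph is treated apart. *)
have [T0|[x0 _]] := set_0Vmem [set: T].
  apply/submxP; exists 0; apply/rowP => j.
  by have := in_setT (enum_val j); rewrite T0 inE.
apply/submxP; exists (w x0)%:M; rewrite mul_scalar_mx; apply/rowP => j.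
by rewrite !mxE mulr1 -(enum_valK j); apply: wC.
Qed.

End AdjacencyMatrices.

(** * Partitions into cells of equal size and their projections *)

Section UniformPartition.
Variables (C : numClosedFieldType) (T : finType) (P : {set {set T}}).
Hypothesis partP : partition P [set: T].
Local Notation er := enum_rank.
Local Notation J := (adjmx C (fun _ _ : T => true)).
Local Notation K := (adjmx C (same_cell P)).

Lemma pblock_same x y : y \in pblock P x -> pblock P y = pblock P x.
Proof. by case/and3P: partP => _ tI _; apply: same_pblock. Qed.

Lemma same_cell_refl : reflexive (same_cell P).
Proof.
by case/and3P: partP => /eqP cP _ _ x; rewrite /same_cell mem_pblock cP inE.
Qed.

Lemma same_cell_sym : symmetric (same_cell P).
Proof.
suff h x y : same_cell P x y -> same_cell P y x.
  by move=> x y; apply/idP/idP; apply: h.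
by rewrite /same_cell => /pblock_same ->; apply: same_cell_refl.
Qed.

Lemma pblock_cell x : pblock P x \in P.
Proof.
by case/and3P: partP => /eqP cP _ _; apply: pblock_mem; rewrite cP inE.
Qed.

Lemma cell_pblock X x : X \in P -> x \in X -> pblock P x = X.
Proof. by case/and3P: partP => _ tI _; apply: def_pblock. Qed.

Lemma cell_point X : X \in P -> exists x, x \in X.
Proof.
by move=> XP; apply/set0Pn; apply: contraTneq XP => ->; case/and3P: partP.
Qed.

Lemma mul_same_cellJ x y : (K *m J) (er x) (er y) = #|pblock P x|%:R.
Proof.
rewrite mul_adjmxE; congr (#|pred_of_set _|%:R).
by apply/setP => z; rewrite inE andbT.
Qed.

Lemma mul_same_cellE x y : (K *m K) (er x) (er y) =
  K (er x) (er y) * #|pblock P x|%:R.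
Proof.
rewrite mul_adjmxE adjmxE -natrM; congr (_%:R); case xy: (same_cell P x y).
  rewrite mul1n; congr (#|pred_of_set _|); apply/setP => z; rewrite inE.
  by rewrite [same_cell P z y]same_cell_sym /same_cell (pblock_same xy) andbb.
rewrite mul0n; apply/eqP; rewrite cards_eq0; apply/eqP/setP => z; rewrite !inE.
apply/negP => /andP[xz]; rewrite {1}/same_cell (pblock_same xz).
by rewrite -/(same_cell P x y) xy.
Qed.

(** Equality of the cell sizes is expressed as a matrix identity, the form in which it is derived
    later; hence [c] is a scalar of [C]. *)
Variable c : C.
Hypothesis uniP : K *m J = c *: J.

Lemma uniform_card_pblock x : #|pblock P x|%:R = c.
Proof.
by rewrite -(mul_same_cellJ x x) uniP mxE adjmxE mulr1.
Qed.

Lemma uniform_card : #|P|%:R * c = #|T|%:R.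
Proof.
rewrite -cardsT (card_partition partP) natr_sum mulr_natl -sumr_const.
apply: eq_bigr => X XP; have [x xX] := cell_point XP.
by rewrite -(cell_pblock XP xX) uniform_card_pblock.
Qed.

Lemma uniform_mulKK : K *m K = c *: K.
Proof.
by apply: rank_matrixP => x y;
  rewrite mul_same_cellE uniform_card_pblock [RHS]mxE mulrC.
Qed.

Lemma uniform_mulJK : J *m K = c *: J.
Proof.
rewrite -[LHS]trmxK trmx_mul (tr_adjmx _ same_cell_sym) tr_J uniP.
by rewrite linearZ /= tr_J.
Qed.

(** For cells of equal size this is the orthogonal projection onto the vectors that are constant on
    cells and have sum zero. *)
Definition cell_projection : 'M[C]_#|T| := #|T|%:R^-1 *: (#|P|%:R *: K - J).
Local Notation E := cell_projection.

Lemma cell_projection_sym : E^T = E.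
Proof.
by rewrite /E linearZ /= linearB /= linearZ /= tr_J (tr_adjmx _ same_cell_sym).
Qed.

Hypothesis T_gt0 : (0 < #|T|)%N.
Let nT0 : #|T|%:R != 0 :> C. Proof. by rewrite pnatr_eq0 -lt0n. Qed.

Lemma cell_projection_idem : E *m E = E.
Proof.
rewrite /E -scalemxAl -scalemxAr; congr (_ *: _).
rewrite mulmxBl !mulmxBr -!scalemxAl -!scalemxAr uniform_mulKK uniP
  uniform_mulJK mul_JJ.
rewrite !scalerA -uniform_card; apply/matrixP => i j; rewrite !mxE.
have cm0 : #|P|%:R * c != 0 by rewrite uniform_card.
by move: cm0; rewrite mulf_eq0 negb_or => /andP[m0 c0]; field; apply/andP.
Qed.

(** The rank of an idempotent is its trace, and [K] and [J] both have trace n, so the trace here is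
    m - 1. *)
Lemma mxrank_cell_projection : (\rank E).+1 = #|P|.
Proof.
apply/eqP; rewrite -(eqr_nat C) -addn1 natrD -(mxtrace_idem
  cell_projection_idem).
rewrite /E linearZ /= linearB /= linearZ /=.
have trefl (f : rel T) : reflexive f -> \tr (adjmx C f) = #|T|%:R.
  move=> rf; rewrite /mxtrace (eq_bigr (fun=> 1)) => [|i _].
    by rewrite sumr_const card_ord.
  by rewrite mxE rf.
rewrite !trefl //; last exact: same_cell_refl.
by rewrite mulrBr mulVf // mulrCA mulVf // mulr1 subrK.
Qed.

End UniformPartition.

(** * Matrix identities for an indubitable partition with parameters (0, b) *)

Section Indubitable.
Variables (C : numClosedFieldType) (T : finType) (e : rel T) (k b : nat).
Variable P : {set {set T}}.
Hypotheses (sym_e : symmetric e) (reg_e : regular_graph e k).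
Hypothesis indP : indubitable e P 0 b.
Local Notation er := enum_rank.
Local Notation J := (adjmx C (fun _ _ : T => true)).
Local Notation K := (adjmx C (same_cell P)).
Local Notation A := (adjmx C e).

Let partP : partition P [set: T]. Proof. by case: indP. Qed.

Lemma indubitable_same_cell x y : e x y -> ~~ same_cell P x y.
Proof.
case: indP => _ hP exy; apply/negP => xy.
have := hP _ x (pblock_cell partP x);
  rewrite -/(same_cell P x x) same_cell_refl //.
by move/eqP; rewrite cards_eq0 => /eqP/setP/(_ y);
  rewrite !inE exy andbT -/(same_cell P x y) xy.
Qed.

Lemma indubitable_mulAK : A *m K = b%:R *: (J - K).
Proof.
apply: rank_matrixP => x y; rewrite mul_adjmxE !mxE !enum_rankK.
case: indP => _ hP.
have -> : #|[set z | e x z && same_cell P z y]| =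
  #|[set z in pblock P y | e x z]|.
  by apply: eq_card => z; rewrite !inE same_cell_sym // andbC.
rewrite hP ?pblock_cell // -/(same_cell P y x) same_cell_sym //.
by case: (same_cell P x y); rewrite ?subrr ?subr0 ?mulr0 ?mulr1.
Qed.

Lemma indubitable_mulKA : K *m A = b%:R *: (J - K).
Proof.
rewrite -[LHS]trmxK trmx_mul (tr_adjmx _ sym_e) (tr_adjmx _ (same_cell_sym
  partP)).
rewrite indubitable_mulAK linearZ /= linearB /= tr_J.
by rewrite (tr_adjmx _ (same_cell_sym partP)).
Qed.

(** The neighbours of [x] are counted cell by cell: none in its own cell, [b] in each other one. *)
Lemma indubitable_degree (x : T) : k = (#|P|.-1 * b)%N.
Proof.
case: indP => _ hP; rewrite -(reg_e x).
have tot : #|[set y | e x y]| = (\sum_(X in P) #|[set y in X | e x y]|)%N.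
  transitivity (\sum_(y in [set: T]) (e x y : nat))%N.
    rewrite -sum1_card [LHS]big_mkcond [RHS]big_mkcond /=;
      apply: eq_bigr => y _.
    by rewrite !inE; case: (e x y).
  rewrite (set_partition_big _ partP) /=; apply: eq_bigr => X _.
  rewrite -sum1_card [LHS]big_mkcond [RHS]big_mkcond /=; apply: eq_bigr => y _.
  by rewrite !inE; case: (y \in X); case: (e x y).
rewrite tot (bigD1 (pblock P x)) ?pblock_cell //= hP ?pblock_cell //.
rewrite -/(same_cell P x x) same_cell_refl // add0n.
rewrite (eq_bigr (fun=> b)); last first.
  move=> X /andP[XP nX]; rewrite hP //; case: ifP => // xX.
  by rewrite (cell_pblock partP XP xX) eqxx in nX.
rewrite sum_nat_const; congr (_ * _)%N.
rewrite (cardD1 (pblock P x) P) pblock_cell //= ; apply: eq_card => X.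
by rewrite !inE andbC.
Qed.

Hypotheses (x0 : T) (k_gt0 : (0 < k)%N).

Lemma indubitable_b_gt0 : (0 < b)%N.
Proof. by move: k_gt0; rewrite (indubitable_degree x0) muln_gt0 => /andP[]. Qed.

Lemma indubitable_cells_gt1 : (1 < #|P|)%N.
Proof.
by move: k_gt0; rewrite (indubitable_degree x0) muln_gt0 => /andP[];
  case: #|P| => [|[]].
Qed.

(** As k = (m - 1) b with b positive, the truncated division is exact. *)
Lemma indubitable_cells : #|P| = (k %/ b).+1.
Proof.
rewrite (indubitable_degree x0) mulnK ?indubitable_b_gt0 //.
by rewrite prednK // ltnW // indubitable_cells_gt1.
Qed.

Let degC : k%:R = (#|P|%:R - 1) * b%:R :> C.
Proof.
rewrite (indubitable_degree x0) natrM -subn1 natrB //.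
by rewrite ltnW // indubitable_cells_gt1.
Qed.

(** Multiplying [K A = b (J - K)] by [J] gives [k K J = b (n J - K J)]; with k = (m - 1) b this
    becomes [m K J = n J]. *)
Lemma indubitable_uniform : K *m J = (#|T|%:R / #|P|%:R) *: J.
Proof.
have b0 : b%:R != 0 :> C by rewrite pnatr_eq0 -lt0n indubitable_b_gt0.
have m0 : #|P|%:R != 0 :> C.
  by rewrite pnatr_eq0 -lt0n ltnW // indubitable_cells_gt1.
have /(congr1 (mulmx^~ J)) := indubitable_mulKA.
rewrite -mulmxA (mul_adjmxJ _ reg_e) -scalemxAr -scalemxAl mulmxBl mul_JJ.
move=> /matrixP h; apply/matrixP => i j.
have := h i j; move: (K *m J) => KJ; rewrite !mxE => hij.
apply: (mulfI b0); apply: (mulfI m0).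
have := congr1 (fun u => u + b%:R * KJ i j) hij.
rewrite degC => hij'.
transitivity ((#|P|%:R - 1) * b%:R * KJ i j + b%:R * KJ i j); first by ring.
by rewrite hij'; field.
Qed.

Lemma indubitable_projection_eigen :
  cell_projection C P *m A = (- b%:R) *: cell_projection C P.
Proof.
rewrite /cell_projection -scalemxAl scalerA mulrC -scalerA; congr (_ *: _).
rewrite mulmxBl -scalemxAl indubitable_mulKA (mul_Jadjmx _ sym_e reg_e) degC.
by apply/matrixP => i j; rewrite !mxE; ring.
Qed.

(** For an eigenvector [v], the factor z - k kills [v J], and (z + b) [v K] = b [v J]. So (z - k)(z
    + b) kills [v M], which is [v] or [z v]; the third root 0 accounts for the case [M = A]. *)
Lemma indubitable_three_eigenvalues (M : 'M[C]_#|T|) a d z :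
    M = 1%:M \/ M = A -> M = a *: J + d *: K -> eigenvalue A z ->
  z \in [:: k%:R; - b%:R; 0].
Proof.
move=> hM ME /eigenvalueP[v vA v0].
have vJ : (z - k%:R) *: (v *m J) = 0.
  apply/eqP; rewrite scalerBl subr_eq0 scalemxAl -vA -mulmxA (mul_adjmxJ _
    reg_e).
  by rewrite -scalemxAr.
have vK : (z + b%:R) *: (v *m K) = b%:R *: (v *m J).
  rewrite scalerDl scalemxAl -vA -mulmxA indubitable_mulAK -scalemxAr mulmxBr
    scalerBr.
  by rewrite subrK.
have vM : ((z - k%:R) * (z + b%:R)) *: (v *m M) = 0.
  rewrite ME mulmxDr -!scalemxAr scalerDr !scalerA.
  have -> : (z - k%:R) * (z + b%:R) * a = (z + b%:R) * a * (z - k%:R) by ring.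
  have -> : (z - k%:R) * (z + b%:R) * d = (z - k%:R) * d * (z + b%:R) by ring.
  rewrite -scalerA vJ scaler0 add0r -[in LHS]scalerA vK scalerA.
  have -> : (z - k%:R) * d * b%:R = d * b%:R * (z - k%:R) by ring.
  by rewrite -scalerA vJ scaler0.
have hz : (z - k%:R) * (z + b%:R) * z = 0.
  move: vM; case: hM => ->; first rewrite mulmx1.
    move/eqP; rewrite scaler_eq0 (negPf v0) orbF => /eqP ->; exact: mul0r.
  by rewrite vA scalerA => /eqP; rewrite scaler_eq0 (negPf v0) orbF => /eqP.
move/eqP: hz; rewrite !mulf_eq0 subr_eq0 addr_eq0 !inE -orbA; by [].
Qed.

End Indubitable.

(** * Entries and dimension of the Bose-Mesner algebra *)

Section BoseMesner.
Variables (C : numClosedFieldType) (T : finType) (d : nat) (B : 'I_d -> rel T).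
Hypothesis simpleB : forall i, simple_graph (B i).
Hypothesis partB : forall x y, x != y -> exists! i, B i x y.
Local Notation er := enum_rank.
Local Notation J := (adjmx C (fun _ _ : T => true)).

Lemma relation_neq i x y : B i x y -> x != y.
Proof. by case: (simpleB i) => _ irr; apply: contraTneq => ->; rewrite irr. Qed.

Lemma relation_inj i j x y : B i x y -> B j x y -> i = j.
Proof.
move=> Bi Bj; have [l [_ hl]] := partB (relation_neq Bi).
by rewrite -(hl _ Bi) -(hl _ Bj).
Qed.

Lemma relation_entry (c : 'I_d -> C) i x y : B i x y ->
  (\sum_j c j *: adjmx C (B j)) (er x) (er y) = c i.
Proof.
move=> Bi; rewrite summxE (bigD1 i) //= [X in X +
  _]mxE adjmxE Bi mulr1 big1 ?addr0 //.
move=> j ji; rewrite mxE adjmxE; case Bj: (B j x y); last by rewrite mulr0.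
by rewrite (relation_inj Bi Bj) eqxx in ji.
Qed.

Lemma relation_diag_entry (c : 'I_d -> C) x :
  (\sum_j c j *: adjmx C (B j)) (er x) (er x) = 0.
Proof.
rewrite summxE big1 // => j _; rewrite mxE adjmxE.
by case: (simpleB j) => _ ->; rewrite mulr0.
Qed.

Let gens := 1%:M :: [seq adjmx C (B i) | i : 'I_d].

Fact size_gens : size gens == d.+1.
Proof. by rewrite /= size_map size_enum_ord. Qed.

Lemma sum_gens (c : 'I_d.+1 -> C) :
  \sum_(i < d.+1) c i *: gens`_i =
  c ord0 *: 1%:M + \sum_(i < d) c (lift ord0 i) *: adjmx C (B i).
Proof.
rewrite big_ord_recl /=; congr (_ + _); apply: eq_bigr => i _; congr (_ *: _).
by rewrite add0n (nth_map i) ?nth_ord_enum ?size_enum_ord.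
Qed.

Lemma Bose_Mesner_entry M : M \in Bose_Mesner C B ->
  exists g : 'I_d -> C, forall i x y, B i x y -> M (er x) (er y) = g i.
Proof.
move=> hM; rewrite (@coord_span _ _ _ (Tuple size_gens) M hM) sum_gens.
exists (fun i => coord (Tuple size_gens) (lift ord0 i) M) => i x y Bi.
rewrite [LHS]mxE (relation_entry _ Bi) !mxE (inj_eq enum_rank_inj).
by rewrite (negPf (relation_neq Bi)) mulr0 add0r.
Qed.

Lemma adjmx_Bose_Mesner i : adjmx C (B i) \in Bose_Mesner C B.
Proof.
by apply: memv_span; rewrite inE; apply/orP; right; apply: image_f.
Qed.

Lemma one_Bose_Mesner : 1%:M \in Bose_Mesner C B.
Proof. by apply: memv_span; rewrite inE eqxx. Qed.

Lemma J_Bose_Mesner : J \in Bose_Mesner C B.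
Proof.
have -> : J = 1%:M + \sum_i (1 : C) *: adjmx C (B i).
  apply: rank_matrixP => x y; rewrite adjmxE [RHS]mxE.
  have [<-|xy] := eqVneq x y.
    by rewrite relation_diag_entry mxE eqxx addr0.
  have [i [Bi _]] := partB xy; rewrite (relation_entry _ Bi) mxE.
  by rewrite (inj_eq enum_rank_inj) (negPf xy) add0r.
rewrite memvD ?one_Bose_Mesner // memv_suml // => i _.
by rewrite memvZ // adjmx_Bose_Mesner.
Qed.

(** The generators are independent: a diagonal entry isolates the coefficient of the identity, and
    an entry at a pair of a nonempty relation isolates the coefficient of that relation. *)
Lemma dim_Bose_Mesner (x0 : T) : (forall i, exists x y, B i x y) ->
  \dim (Bose_Mesner C B) = d.+1.
Proof.
move=> neB; suff /eqP : free (Tuple size_gens) by rewrite (eqP size_gens).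
apply/freeP => c; rewrite sum_gens => h.
have c0 : c ord0 = 0.
  have /matrixP/(_ (er x0) (er x0)) := h.
  by rewrite mxE relation_diag_entry !mxE eqxx mulr1 addr0.
move=> i; case: (unliftP ord0 i) => [j ->|-> //].
have [x [y Bj]] := neB j; have /matrixP/(_ (er x) (er y)) := h.
by rewrite c0 scale0r add0r (relation_entry (fun j => c (lift ord0 j)) Bj) mxE.
Qed.

End BoseMesner.

Local Notation o0 := (@Ordinal 3 0 isT).
Local Notation o1 := (@Ordinal 3 1 isT).
Local Notation o2 := (@Ordinal 3 2 isT).

(** Reduces to closed indices, on which [nth] and equality tests compute. *)
Lemma ord3_cases (Q : 'I_3 -> Prop) : Q o0 -> Q o1 -> Q o2 -> forall i, Q i.
Proof.
move=> q0 q1 q2 [[|[|[|i]]] hi] //.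
- by rewrite (_ : Ordinal hi = o0) //; apply: val_inj.
- by rewrite (_ : Ordinal hi = o1) //; apply: val_inj.
- by rewrite (_ : Ordinal hi = o2) //; apply: val_inj.
Qed.

Lemma ord3_eq (i j l i0 : 'I_3) :
  j != i0 -> l != j -> l != i0 -> i != j -> i != l -> i0 = i.
Proof.
by elim/ord3_cases: i; elim/ord3_cases: j; elim/ord3_cases: l;
  elim/ord3_cases: i0.
Qed.

(** * Graphs with four distinct eigenvalues *)

Section FourEigenvalues.
Variables (C : numClosedFieldType) (T : finType) (e : rel T) (k b : nat).
Variable P : {set {set T}}.
Hypotheses (sym_e : symmetric e) (irr_e : irreflexive e).
Hypotheses (con_e : connected_graph e) (reg_e : regular_graph e k).
Variable s : seq C.
Hypotheses (uniq_s : uniq s) (size_s : size s = 4).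
Hypothesis mem_s : forall z, (z \in s) = eigenvalue (adjmx C e) z.
Hypothesis indP : indubitable e P 0 b.
Local Notation er := enum_rank.
Local Notation J := (adjmx C (fun _ _ : T => true)).
Local Notation K := (adjmx C (same_cell P)).
Local Notation A := (adjmx C e).

Let partP : partition P [set: T]. Proof. by case: indP. Qed.

Lemma not_three_eigenvalues (t : seq C) : (size t < 4)%N ->
  ~ (forall z, eigenvalue A z -> z \in t).
Proof.
move=> st h; have sub : {subset s <= t} by move=> z; rewrite mem_s; apply: h.
by have := uniq_leq_size uniq_s sub; rewrite size_s leqNgt st.
Qed.

(** [connected_graph] holds for the empty graph, so a vertex has to come from the spectrum: a matrix
    of size 0 has no eigenvalue. *)
Lemma graph_point : exists x : T, true.
Proof.
have [T0|[x _]] := set_0Vmem [set: T]; last by exists x.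
case: (@not_three_eigenvalues [::]) => // z /eigenvalueP[v _ /eqP[]].
by apply/rowP => j; have := in_setT (enum_val j); rewrite T0 inE.
Qed.

Lemma graph_edge : exists x y, e x y.
Proof.
case: (boolP [exists x, exists y, e x y]) => [/existsP[x /existsP[y exy]]|ne].
  by exists x, y.
case: (@not_three_eigenvalues [:: 0]) => // z /eigenvalueP[v].
have -> : A = 0.
  apply: rank_matrixP => x y; rewrite adjmxE mxE; case exy: (e x y) => //.
  by case/negP: ne; apply/existsP; exists x; apply/existsP; exists y.
rewrite mulmx0 => /esym/eqP; rewrite scaler_eq0 inE => /orP[//|/eqP ->].
by rewrite eqxx.
Qed.

Lemma degree_gt0 : (0 < k)%N.
Proof.
have [x [y exy]] := graph_edge; rewrite -(reg_e x) card_gt0.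
by apply/set0Pn; exists y; rewrite inE.
Qed.

Let k_gt0 := degree_gt0.

Let T_gt0 : (0 < #|T|)%N.
Proof. by have [x _] := graph_point; apply/card_gt0P; exists x. Qed.

(** [J / n] is the projection onto the eigenspace of k, which connectivity makes one-dimensional. *)
Lemma J_powspan : powspan A J.
Proof.
have n0 : #|T|%:R != 0 :> C by rewrite pnatr_eq0 -lt0n.
pose E : 'M[C]_#|T| := #|T|%:R^-1 *: J.
have EE : E *m E = E.
  rewrite /E -scalemxAl -scalemxAr; congr (_ *: _).
  by rewrite mul_JJ scalerA mulVf // scale1r.
have EA : E *m A = k%:R *: E.
  by rewrite /E -scalemxAl (mul_Jadjmx _ sym_e reg_e) !scalerA mulrC.
have E0 : E != 0.
  rewrite scaler_eq0 invr_eq0 (negPf n0) /=; apply/eqP => J0.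
  by have [x _] := graph_point; have := adjmx_eq0 J0 x x.
have sE : (E <= eigenspace A k%:R)%MS by apply/eigenspaceP.
have rE : \rank E = \rank (eigenspace A k%:R).
  apply/eqP; rewrite eqn_leq mxrankS //=.
  apply: leq_trans (regular_connected_eigenspace C sym_e con_e reg_e) _.
  by rewrite lt0n mxrank_eq0.
have : powspan A E.
  apply: (powspan_eigenprojection (tr_adjmx C sym_e) (adjmx_real C e) uniq_s
           _ _ _ EE EA rE).
  - by move=> z; rewrite -mem_s.
  - rewrite mem_s /eigenvalue; apply: contra E0 => /eqP h0.
    by move: sE; rewrite h0 submx0.
  - by rewrite linearZ /= tr_J.
by move=> /(powspanZ #|T|%:R); rewrite scalerA divff // scale1r.
Qed.

(** In order: the graph, same cell, and different cells without adjacency. The default [e] of [nth]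
    is never reached. *)
Definition cell_scheme : 'I_3 -> rel T := fun i =>
  nth e [:: e; (fun x y => (x != y) && same_cell P x y);
           (fun x y => ~~ same_cell P x y && ~~ e x y)] i.

Lemma cell_scheme_simple i : simple_graph (cell_scheme i).
Proof.
elim/ord3_cases: i; split=> //= x.
- by move=> y; rewrite /cell_scheme /= eq_sym (same_cell_sym partP).
- by rewrite /cell_scheme /= eqxx.
- by move=> y; rewrite /cell_scheme /= (same_cell_sym partP) sym_e.
- by rewrite /cell_scheme /= (same_cell_refl partP).
Qed.

Lemma cell_scheme_partition x y : x != y -> exists! i, cell_scheme i x y.
Proof.
move=> xy; have dis := indubitable_same_cell indP (x := x) (y := y).
case exy: (e x y).
  exists o0; split=> //.
  by apply: ord3_cases; rewrite /cell_scheme /= ?exy ?(negPf (dis exy)) ?andbF.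
case cxy: (same_cell P x y).
  exists o1; split=> [|]; first by rewrite /cell_scheme /= xy.
  by apply: ord3_cases; rewrite /cell_scheme /= ?exy ?cxy.
exists o2; split=> [|]; first by rewrite /cell_scheme /= exy cxy.
by apply: ord3_cases; rewrite /cell_scheme /= ?exy ?cxy ?andbF.
Qed.

Lemma span_JK_excludes_1_A (M : 'M[C]_#|T|) a d :
  M = 1%:M \/ M = A -> M = a *: J + d *: K -> False.
Proof.
move=> hM ME; apply: (@not_three_eigenvalues [:: k%:R; - b%:R; 0]) => // z.
exact: (indubitable_three_eigenvalues reg_e indP hM ME).
Qed.

(** If the second relation were empty, [K] would be the identity; if the third were, [A] would be
    [J - K]. *)
Lemma cell_scheme_nonempty i : exists x y, cell_scheme i x y.
Proof.
case: (boolP [exists x, exists y, cell_scheme i x y]).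
  by move=> /existsP[x /existsP[y h]]; exists x, y.
move=> /existsPn ne.
have {}ne x y : cell_scheme i x y = false.
  by apply/negP => h; case/negP: (ne x); apply/existsP; exists y.
elim/ord3_cases: i ne => ne.
- by have [x [y exy]] := graph_edge; have := ne x y;
  rewrite /cell_scheme /= exy.
- case: (@span_JK_excludes_1_A 1%:M 0 1); first by left.
  rewrite scale0r add0r scale1r; apply: rank_matrixP => x y.
  have := ne x y; rewrite /cell_scheme /= adjmxE mxE (inj_eq enum_rank_inj).
  by case: eqVneq => [<- _|_ /= ->]; rewrite ?same_cell_refl.
- case: (@span_JK_excludes_1_A A 1 (-1)); first by right.
  rewrite scale1r scaleN1r; apply: rank_matrixP => x y.
  have := ne x y; rewrite /cell_scheme /= !mxE !enum_rankK.
  have := indubitable_same_cell indP (x := x) (y := y).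
  case: (same_cell P x y); case: (e x y) => //= h; rewrite ?subrr ?subr0 //.
  by have := h isT.
Qed.

Lemma adjmx_cell_scheme1 : adjmx C (cell_scheme o1) = K - 1%:M.
Proof.
apply: rank_matrixP => x y; rewrite !mxE !enum_rankK (inj_eq enum_rank_inj).
rewrite /cell_scheme /=; case: eqVneq => [<-|_] /=; last by rewrite subr0.
by rewrite same_cell_refl ?subrr.
Qed.

Lemma adjmx_cell_scheme2 : adjmx C (cell_scheme o2) = J - K - A.
Proof.
apply: rank_matrixP => x y; rewrite !mxE !enum_rankK /cell_scheme /=.
have := indubitable_same_cell indP (x := x) (y := y).
case: (same_cell P x y); case: (e x y) => /= h; rewrite ?subr0 ?subrr ?subr0 //.
by have := h isT.
Qed.

(** * A full partition yields the scheme *)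

Lemma full_scheme : full_partition C e P 0 b ->
  exists B : 'I_3 -> rel T,
     [/\ association_scheme C B, imprimitive_scheme B, generates_scheme C B e
       & exists j : 'I_3, ~ (B j =2 e) /\
           disjoint_union_of_cliques (B j) (k %/ b).+1].
Proof.
case=> r [r0 Pr rm]; have [x0 _] := graph_point.
have uniP := indubitable_uniform C sym_e reg_e indP x0 k_gt0.
have Kpow : powspan A K.
  have EE := cell_projection_idem partP uniP T_gt0.
  have EA := indubitable_projection_eigen C sym_e reg_e indP x0 k_gt0.
  have rE := mxrank_cell_projection partP uniP T_gt0.
  have Epow : powspan A (cell_projection C P).
    apply: (powspan_eigenprojection (tr_adjmx C sym_e) (adjmx_real C e) uniq_s
             _ _ _ EE EA) => //.
    - by move=> z; rewrite -mem_s.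
    (* Here - b is an eigenvalue because its multiplicity [r] is positive. *)
    - rewrite mem_s /eigenvalue -mxrank_eq0 -lt0n.
      by move: rm; rewrite /eigenvalue_multiplicity sub0r => <-.
    - exact: cell_projection_sym.
    - by move: rm; rewrite /eigenvalue_multiplicity sub0r => <-;
      rewrite Pr in rE; case: rE.
  have n0 : #|T|%:R != 0 :> C by rewrite pnatr_eq0 -lt0n.
  have m0 : #|P|%:R != 0 :> C by rewrite Pr pnatr_eq0.
  have -> : K = #|P|%:R^-1 *: (#|T|%:R *: cell_projection C P + J).
    rewrite /cell_projection [#|T|%:R *: _]scalerA divff // scale1r subrK.
    by rewrite scalerA mulVf // scale1r.
  by apply/powspanZ/powspanD; [apply: powspanZ|apply: J_powspan].
(* Four powers suffice, since the product of the ['X - z%:P] over the four eigenvalues annihilates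
   [A]. *)
pose W := <<[seq A ^+ i | i <- iota 0 4]>>%VS.
have WP M : powspan A M <-> M \in W.
  split; last exact: vspace_powspan.
  have sA z : eigenvalue A z -> z \in s by rewrite -mem_s.
  have := real_symmetric_annihilator (tr_adjmx C sym_e) (adjmx_real C e) sA.
  apply: powspan_vspace; first by rewrite size_prod_XsubC size_s.
  by rewrite -size_poly_eq0 size_prod_XsubC.
(* One inclusion is enough: [W] has dimension at most 4, which is the dimension of the Bose-Mesner
   algebra. *)
have BW : Bose_Mesner C cell_scheme = W.
  apply/eqP; rewrite eqEdim; apply/andP; split; last first.
    rewrite (dim_Bose_Mesner C cell_scheme_simple cell_scheme_partition x0
      cell_scheme_nonempty).
    by apply: leq_trans (dim_span _) _; rewrite size_map size_iota.
  apply/span_subvP => M; rewrite inE => /orP[/eqP ->|/mapP[i _ ->]].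
    by apply/WP; apply: powspan1.
  apply/WP; elim/ord3_cases: i; first exact: powspan_id.
    by rewrite adjmx_cell_scheme1; apply: powspanB => //; apply: powspan1.
  rewrite adjmx_cell_scheme2; apply: powspanB; last exact: powspan_id.
  by apply: powspanB => //; apply: J_powspan.
have o1e : ~ cell_scheme o1 =2 e.
  have [x [y exy]] := graph_edge => /(_ x y); rewrite exy /cell_scheme /=.
  by rewrite (negPf (indubitable_same_cell indP exy)) andbF.
exists cell_scheme; split.
- split; [exact: cell_scheme_simple|exact: cell_scheme_nonempty
         |exact: cell_scheme_partition|].
  by rewrite BW => M N /WP hM /WP hN; apply/WP; apply: powspanM.
(* A path of the second relation never leaves its cell, so it cannot join the ends of an edge of the
   graph. *)
- exists o1 => con; have [x [y exy]] := graph_edge.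
  have /negP := indubitable_same_cell indP exy; apply.
  have /connectP[p] := con x y; elim: p x {exy} => [|z p IH] x /=.
    by move=> _ ->; apply: same_cell_refl.
  rewrite {1}/cell_scheme /= => /andP[/andP[_ xz] pz] yE.
  by rewrite /same_cell -(pblock_same partP xz); apply: IH.
- split; first by exists o0.
  by rewrite BW => M; apply: WP.
- exists o1; split=> //; exists P; split=> //.
  exact: (indubitable_cells reg_e indP x0 k_gt0).
Qed.

(** * The scheme forces the partition to be full *)

Lemma scheme_full (B : 'I_3 -> rel T) j :
    association_scheme C B -> generates_scheme C B e -> ~ (B j =2 e) ->
    disjoint_union_of_cliques (B j) (k %/ b).+1 ->
  full_partition C e P 0 b.
Proof.
case=> simpleB _ partB mulB [[i0 Bi0] genB] jNe [Q [partQ cardQ BjE]].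
have [x0 _] := graph_point.
have cP := indubitable_cells reg_e indP x0 k_gt0.
have j_i0 : j != i0 by apply/eqP => h; apply: jNe => x y; rewrite h Bi0.
pose L := adjmx C (same_cell Q).
have LE : L = 1%:M + adjmx C (B j).
  apply: rank_matrixP => x y;
    rewrite !mxE !enum_rankK (inj_eq enum_rank_inj) BjE.
  by case: eqVneq => [<-|_]; rewrite /= ?same_cell_refl ?addr0 ?add0r.
have eNL x y : e x y -> ~~ same_cell Q x y.
  move=> exy; apply/negP => qxy; case/eqP: j_i0.
  apply: (relation_inj simpleB partB (x := x) (y := y)); last by rewrite Bi0.
  rewrite BjE; apply/andP; split=> //; apply: contraTneq exy => ->.
  by rewrite irr_e.
have LB : L \in Bose_Mesner C B.
  by rewrite LE memvD ?one_Bose_Mesner ?adjmx_Bose_Mesner.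
have Lpow : powspan A L by apply/genB.
have Jpow : powspan A J by apply/genB/J_Bose_Mesner.
(* The rows of [J] are eigenvectors for k, so the polynomial [L] in [A] scales them; transposing
   exchanges the factors. Thus all cliques have size [c]. *)
have [c uniQ] : exists c, L *m J = c *: J.
  have [c hc] := powspan_eigen k%:R Lpow; exists c.
  rewrite -[LHS]trmxK trmx_mul tr_J (tr_adjmx _ (same_cell_sym partQ)).
  by rewrite (hc _ _ (mul_Jadjmx _ sym_e reg_e)) linearZ /= tr_J.
have [g gE] : exists g : 'I_3 -> C,
    forall i x y, B i x y -> (A *m L) (er x) (er y) = g i.
  apply: (Bose_Mesner_entry simpleB partB); apply: mulB => //.
  by apply/genB/powspan_id.
have ALE x y : (A *m L) (er x) (er y) = #|[set z in pblock Q y | e x z]|%:R.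
  rewrite mul_adjmxE; congr (_%:R); apply: eq_card => z.
  by rewrite !inE (same_cell_sym partQ) andbC.
have AL0 x y : same_cell Q x y -> #|[set z in pblock Q y | e x z]| = 0%N.
  move=> xy; apply/eqP; rewrite cards_eq0; apply/eqP/setP => z; rewrite !inE.
  apply/negP => /andP[]; rewrite (pblock_same partQ xy) => xz /eNL.
  by rewrite /same_cell xz.
have [x1 [y1 exy1]] := graph_edge.
(* The dichotomy is whether the entries of [A L] at pairs from different cliques all equal [g i0],
   the value on edges. *)
case: (boolP [forall x, forall y, same_cell Q x y || ((A *m L) (er x) (er y)
  == g i0)]).
  move=> h; pose b' := #|[set z in pblock Q y1 | e x1 z]|.
  have gb : g i0 = b'%:R by rewrite -ALE; apply/esym/gE; rewrite Bi0.
  have indQ : indubitable e Q 0 b'.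
    split=> // X x XQ; have [y yX] := cell_point partQ XQ.
    rewrite -(cell_pblock partQ XQ yX) -/(same_cell Q y x) (same_cell_sym
      partQ).
    case: ifP => [|nxy]; first exact: AL0.
    have /forallP/(_ x)/forallP/(_ y) := h; rewrite nxy /= ALE gb eqr_nat.
    by move/eqP.
  (* Both partitions have the same number m of cells, and k = (m - 1) b = (m - 1) b'. *)
  have bb : b' = b.
    have := indubitable_degree reg_e indP x0.
    rewrite (indubitable_degree reg_e indQ x0) cardQ cP /= => /eqP.
    rewrite eqn_pmul2l; first by move/eqP.
    by have := indubitable_cells_gt1 reg_e indP x0 k_gt0; rewrite cP.
  rewrite bb in indQ.
  have EE := cell_projection_idem partQ uniQ T_gt0.
  have EA := indubitable_projection_eigen C sym_e reg_e indQ x0 k_gt0.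
  have rE := mxrank_cell_projection partQ uniQ T_gt0.
  have r_gt0 : (0 < k %/ b)%N.
    by have := indubitable_cells_gt1 reg_e indP x0 k_gt0; rewrite cP.
  have E0 : cell_projection C Q != 0.
    by rewrite -mxrank_eq0 -lt0n -ltnS rE cardQ ltnS.
  have Epow : powspan A (cell_projection C Q).
    by apply/powspanZ/powspanB => //; apply: powspanZ.
  exists (k %/ b)%N; split=> //.
  rewrite /eigenvalue_multiplicity sub0r (powspan_idem_eigenspace Epow EE E0
    EA).
  by apply/eqP; rewrite -eqSS rE cardQ.
(* In the other case the offending pair lies in the third relation [l], where [A L] takes a value
   other than on edges. *)
rewrite negb_forall => /existsP[x2]; rewrite negb_forall => /existsP[y2].
rewrite negb_or => /andP[nxy2 g2].
have xy2 : x2 != y2 by apply: contraNneq nxy2 => ->; apply: same_cell_refl.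
have [l [Bl _]] := partB _ _ xy2.
have l_j : l != j.
  by apply: contraNneq nxy2 => lj; move: Bl; rewrite lj BjE => /andP[].
have gl : g l != g i0 by rewrite -(gE _ _ _ Bl).
have l_i0 : l != i0 by apply: contraNneq gl => ->.
(* The entry of [A L] at (x, z) equals the one at (x, y), as [y] and [z] share a clique. This
   excludes [l], and [j] is excluded too, so [x] and [z] are adjacent. *)
have sat x y z : e x y -> same_cell Q y z -> e x z.
  move=> exy yz.
  have nxz : ~~ same_cell Q x z.
    apply: contra (eNL _ _ exy) => xz;
      rewrite /same_cell -(pblock_same partQ xz).
    by rewrite -/(same_cell Q z y) (same_cell_sym partQ).
  have xz : x != z by apply: contraNneq nxz => ->; apply: same_cell_refl.
  have [i [Bi _]] := partB _ _ xz.
  have ij : i != j by apply: contraNneq nxz => ij; move: Bi;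
    rewrite ij BjE => /andP[].
  have il : i != l.
    apply: contraNneq gl => il; rewrite -il -(gE _ _ _ Bi).
    have ei0 : B i0 x y by rewrite Bi0.
    by rewrite -(gE _ _ _ ei0) !ALE (pblock_same partQ yz).
  suff -> : e x z = B i x z by [].
  by rewrite -Bi0 (ord3_eq j_i0 l_j l_i0 ij il).
have AL : A *m L = c *: A.
  apply: rank_matrixP => x y; rewrite ALE [RHS]mxE adjmxE.
  case exy: (e x y); last first.
    rewrite mulr0; apply/eqP; rewrite pnatr_eq0 cards_eq0; apply/eqP/setP => z.
    rewrite !inE; apply/negP => /andP[yz exz]; move: exy.
    by rewrite (sat x z) // (same_cell_sym partQ).
  rewrite mulr1 -(uniform_card_pblock uniQ y); congr (_%:R).
  apply: eq_card => z; rewrite !inE; case yz: (z \in pblock Q y) => //=.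
  exact: sat exy yz.
have b0 : b%:R != 0 :> C.
  by rewrite pnatr_eq0 -lt0n (indubitable_b_gt0 reg_e indP x0 k_gt0).
have m0 : #|P|%:R != 0 :> C by rewrite cP pnatr_eq0.
(* Multiplying [L A = c A] by [K] and cancelling b gives [L (J - K) = c (J - K)], while
   [L J = c J]. *)
have LK : L *m K = c *: K.
  have LA : L *m A = c *: A.
    have := congr1 trmx AL; rewrite linearZ /= trmx_mul (tr_adjmx _ sym_e).
    by rewrite (tr_adjmx _ (same_cell_sym partQ)).
  have := congr1 (mulmx^~ K) LA.
  rewrite -mulmxA -scalemxAl (indubitable_mulAK C indP) -scalemxAr scalerA
    mulrC -scalerA.
  move/(scalerI b0); rewrite mulmxBr uniQ scalerBr.
  by move/(congr1 (fun M => c *: J - M)); rewrite !subKr.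
have uniP := indubitable_uniform C sym_e reg_e indP x0 k_gt0.
have cE : #|T|%:R / #|P|%:R = c.
  by rewrite -(uniform_card partQ uniQ) cardQ -cP mulrC (mulKf m0).
rewrite cE in uniP.
(* The diagonal entry of [L K = c K] at [x] says that the clique and the cell of [x] meet in [c]
   vertices, the size of either one. *)
have blockE x : pblock Q x = pblock P x.
  have sQP : pblock Q x \subset pblock P x.
    have /matrixP/(_ (er x) (er x)) := LK.
    rewrite mul_adjmxE [RHS]mxE adjmxE (same_cell_refl partP) mulr1.
    rewrite -(uniform_card_pblock uniQ x) => /eqP; rewrite eqr_nat => /eqP h.
    have sub : [set z | same_cell Q x z && same_cell P z x] \subset pblock Q x.
      by apply/subsetP => z; rewrite inE => /andP[].
    have /eqP <- : [set z | same_cell Q x z && same_cell P z x] == pblock Q x.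
      by rewrite eqEcard sub h leqnn.
    by apply/subsetP => z; rewrite inE (same_cell_sym partP) => /andP[].
  apply/eqP; rewrite eqEcard sQP -(ler_nat C).
  by rewrite (uniform_card_pblock uniQ) (uniform_card_pblock uniP) lexx.
have LeqK : L = K by apply: eq_adjmx => x y; rewrite /same_cell blockE.
have c0 : c != 0.
  rewrite -(uniform_card_pblock uniQ x0) pnatr_eq0 cards_eq0.
  by apply/set0Pn; exists x0; apply: (same_cell_refl partQ).
(* With [L = K], the identities [A K = c A] and [A K = b (J - K)] give [A = (b / c) (J - K)]. *)
case: (@span_JK_excludes_1_A A (c^-1 * b%:R) (- (c^-1 * b%:R))); first by right.
rewrite scaleNr -scalerBr -scalerA -(indubitable_mulAK C indP) -LeqK AL.
by rewrite scalerA mulVf // scale1r.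
Qed.

End FourEigenvalues.

Theorem proposition4p3 (C : numClosedFieldType) (T : finType) (e : rel T)
    (k b : nat) (P : {set {set T}}) :
  simple_graph e ->
  connected_graph e ->
  regular_graph e k ->
  num_distinct_eigenvalues C e 4 ->
  indubitable e P 0 b ->
  (exists B : 'I_3 -> rel T,
     [/\ association_scheme C B,
         imprimitive_scheme B,
         generates_scheme C B e
       & exists j : 'I_3, ~ (B j =2 e) /\
           disjoint_union_of_cliques (B j) (k %/ b).+1])
  <-> full_partition C e P 0 b.
Proof.
move=> [sym_e irr_e] con_e reg_e [s [us ss ms]] indP; split.
  case=> B [asB _ genB [j [jNe cliq]]].
  exact: (scheme_full sym_e irr_e reg_e us ss ms indP asB genB jNe cliq).
exact: (full_scheme sym_e irr_e con_e reg_e us ss ms indP).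
Qed.
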